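(* There is a constant $C$ such that for every $N\ge 2$ there exists an exact quantum query algorithm (in the model described in the context) that, for every non-decreasing $x\in\{0,1\}^N$ with $x_{N-1}=1$, outputs $f(x)=\min\{0\le i<N: x_i=1\}$ with certainty and uses at most $\log_3(N)+C$ queries.
   Context: Quantum query model: the algorithm acts on a Hilbert space with orthonormal basis $\{|z;i\rangle : z,i \text{ non-negative integers}\}$. For an input $x\in\{0,1\}^N$ the oracle is the unitary $O_x|z;i\rangle=(-1)^{x_i}|z;i\rangle$ if $0\le i<N$ and $O_x|z;i\rangle=|z;i\rangle$ if $i\ge N$. A quantum algorithm with $T$ queries is a unitary $(U O_x)^T U$ for a fixed unitary $U$ independent of $x$, applied to $|0\rangle$, followed by a measurement in the computational basis and reading of an output register. It is exact if for every admissible input the output equals the correct answer with probability 1. *)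

(* Defs.v *)
From Stdlib Require Import Rdefinitions Raxioms Rfunctions Rpower.
From mathcomp Require Import all_boot all_order all_algebra all_field.
Set Implicit Arguments. Unset Strict Implicit. Unset Printing Implicit Defensive.
Import GRing.Theory Num.Theory.
Local Open Scope ring_scope.

(* Truncated state space: basis |z;i> with z < Zd and i < Md, encoded as the
   index k = z * Md + i of 'I_(Zd * Md); so z = k %/ Md and i = k %% Md. *)

Definition unitary (d : nat) (U : 'M[algC]_d) : Prop :=
  U *m (map_mx Num.conj U)^T = 1%:M.

Definition xbit (N : nat) (x : N.-tuple bool) (i : nat) : bool := nth false x i.

Definition oracle (N Zd Md : nat) (x : N.-tuple bool) : 'M[algC]_(Zd * Md) :=
  \matrix_(k, l)
    (if k == l then
       (if (((k %% Md)%N < N)%N && xbit x (k %% Md)%N) then -1 else 1)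
     else 0).

Definition ket0 (d : nat) : 'cV[algC]_d := \col_k (((k : nat) == 0%N)%:R).

Definition final_state (N Zd Md T : nat) (U : 'M[algC]_(Zd * Md))
    (x : N.-tuple bool) : 'cV[algC]_(Zd * Md) :=
  iter T (fun v => U *m (oracle Zd Md x *m v)) (U *m ket0 (Zd * Md)).

Definition admissible (N : nat) (x : N.-tuple bool) : Prop :=
  (forall i j, (i <= j)%N -> (j < N)%N -> xbit x i -> xbit x j)
  /\ xbit x N.-1 = true.

Definition first_one (N : nat) (x : N.-tuple bool) : nat := find id x.

(* Exactness: measuring in the computational basis gives, with probability 1,
   a basis state |z;i> whose output register z equals f(x); i.e. every basis
   state with nonzero amplitude has z = f(x). *)
Definition exact_for (N Zd Md T : nat) (U : 'M[algC]_(Zd * Md)) : Prop :=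
  forall x : N.-tuple bool, admissible x ->
  forall k : 'I_(Zd * Md), final_state T U x k 0 != 0 ->
    (k %/ Md)%N = first_one x.

(* Main.v *)
(* The input x is determined by f = first_one x, and a T-query algorithm exists
   as soon as there are T families of states whose Gram matrices, indexed by f,
   chain together: the Gram matrix before the first query is all ones, the one
   after a query is the one before the next query, and the last is the identity.
   Indeed families with equal Gram matrices are related by a unitary.

   Such chains compose: searching among the n block boundaries and then inside a
   block of length m solves size n * m with the sum of the query counts. It
   remains to search 27 items with 3 queries, as log_27 = (log_3) / 3. With
   states that are cyclic shifts of one another, a query turns periodic shifts
   into antiperiodic ones, and the chain reduces to two trigonometric polynomials
   of degree 26 being nonnegative. Each is, up to scaling, the squared modulus of
   an integer polynomial plus a residual dominated by its constant term. *)
Require Import Defs.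
From Stdlib Require Import Rdefinitions Raxioms Rfunctions Rpower RIneq Lra.
From mathcomp Require Import all_boot all_order all_algebra all_field.
From mathcomp Require Import ring zify ssrZ.
Set Implicit Arguments. Unset Strict Implicit. Unset Printing Implicit Defensive.
Import Order.TTheory GRing.Theory Num.Theory.
Local Open Scope ring_scope.

(** * Gram matrices and unitary equivalence of families of vectors *)

Section Gram.
Variable d : nat.
Implicit Types (u v w : 'cV[algC]_d) (A B : 'M[algC]_d).

Definition adjmx m n (A : 'M[algC]_(m, n)) := (map_mx Num.conj A)^T.
Definition dotc u v : algC := (adjmx u *m v) 0 0.

Lemma dotcE u v : dotc u v = \sum_i (u i 0)^* * v i 0.
Proof. by rewrite /dotc mxE; apply: eq_bigr => i _; rewrite !mxE. Qed.

Lemma adjmxM m n p (A : 'M[algC]_(m, n)) (B : 'M_(n, p)) :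
  adjmx (A *m B) = adjmx B *m adjmx A.
Proof. by rewrite /adjmx map_mxM trmx_mul. Qed.

Lemma adjmxK m n (A : 'M[algC]_(m, n)) : adjmx (adjmx A) = A.
Proof. by apply/matrixP => i j; rewrite !mxE conjCK. Qed.

Lemma dotcC u v : dotc v u = (dotc u v)^*.
Proof.
rewrite !dotcE rmorph_sum; apply: eq_bigr => i _.
by rewrite rmorphM /= conjCK mulrC.
Qed.

Lemma dotcDr u v w : dotc u (v + w) = dotc u v + dotc u w.
Proof. by rewrite /dotc mulmxDr mxE. Qed.

Lemma dotcZr a u v : dotc u (a *: v) = a * dotc u v.
Proof. by rewrite /dotc -scalemxAr mxE. Qed.

Lemma dotcDl u v w : dotc (u + v) w = dotc u w + dotc v w.
Proof. by rewrite dotcC dotcDr rmorphD /= -!dotcC. Qed.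

Lemma dotcZl a u v : dotc (a *: u) v = a^* * dotc u v.
Proof. by rewrite dotcC dotcZr rmorphM /= -dotcC. Qed.

Lemma dotc0l u : dotc 0 u = 0.
Proof. by rewrite -(scale0r 0) dotcZl rmorph0 mul0r. Qed.

Lemma dotcBl u v w : dotc (u - v) w = dotc u w - dotc v w.
Proof. by rewrite -scaleN1r dotcDl dotcZl rmorphN1 mulN1r. Qed.

Lemma dotcBr u v w : dotc u (v - w) = dotc u v - dotc u w.
Proof. by rewrite -scaleN1r dotcDr dotcZr mulN1r. Qed.

Lemma dotcc_eq0 u : (dotc u u == 0) = (u == 0).
Proof.
apply/idP/eqP => [|->]; last by rewrite dotc0l.
rewrite dotcE psumr_eq0 => [/allP u0|i _]; last by rewrite mulrC mul_conjC_ge0.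
apply/matrixP => i j; rewrite (ord1 j) mxE; apply/eqP.
by rewrite -mul_conjC_eq0 mulrC (eqP (u0 i (mem_index_enum i))).
Qed.

Lemma dotc_unitary U u v : unitary U -> dotc (U *m u) (U *m v) = dotc u v.
Proof.
move=> /mulmx1C UU; rewrite /dotc adjmxM -mulmxA (mulmxA _ U).
by rewrite [adjmx U *m U]UU mul1mx.
Qed.

Lemma unitaryM A B : unitary A -> unitary B -> unitary (A *m B).
Proof.
rewrite /unitary => uA uB; rewrite -/(adjmx _) adjmxM -mulmxA (mulmxA B).
by rewrite [B *m adjmx B]uB mul1mx.
Qed.

Lemma mulmx_dotc u v w : u *m adjmx v *m w = dotc v w *: u.
Proof.
rewrite -mulmxA [adjmx v *m w]mx11_scalar -/(dotc v w).
by rewrite mul_mx_scalar.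
Qed.

(* A complex reflection: the coefficient <v - w | v>^-1 makes it unitary even
   when <v | w> is not real. *)
Lemma reflection v w : dotc v v = dotc w w ->
  exists2 H : 'M[algC]_d, unitary H &
    H *m v = w /\ forall u, dotc (v - w) u = 0 -> H *m u = u.
Proof.
move=> vw; set z := v - w; set a := dotc z v.
have zz : dotc z z = a + a^*.
  rewrite {2}/z dotcBr -/a; congr (_ + _).
  by rewrite /a -dotcC /z dotcBl dotcBr vw opprB.
have [a0|a0] := eqVneq a 0.
  have /eqP : dotc z z = 0 by rewrite zz a0 rmorph0 addr0.
  rewrite dotcc_eq0 subr_eq0 => /eqP ->; exists 1%:M.
    by rewrite /unitary map_mx1 trmx1 mulmx1.
  by rewrite mul1mx; split=> // u _; rewrite mul1mx.
have HE u : (1%:M - a^-1 *: (z *m adjmx z)) *m u = u - (a^-1 * dotc z u) *: z.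
  by rewrite mulmxBl mul1mx -scalemxAl mulmx_dotc scalerA.
exists (1%:M - a^-1 *: (z *m adjmx z)); last first.
  split=> [|u zu]; rewrite HE.
    by rewrite mulVf // scale1r opprB addrC subrK.
  by rewrite zu mulr0 scale0r subr0.
pose P := z *m adjmx z; rewrite /unitary -/(adjmx _) -/P.
have PP : P *m P = (a + a^*) *: P.
  by rewrite /P mulmxA mulmx_dotc zz -scalemxAl.
have -> : adjmx (1%:M - a^-1 *: P) = 1%:M - (a^*)^-1 *: P.
  have {2}-> : P = adjmx P by rewrite /P adjmxM adjmxK.
  apply/matrixP => i j; rewrite !mxE rmorphB rmorphM fmorphV rmorph_nat eq_sym.
  by rewrite mulrC [X in _ - X]mulrC.
rewrite mulmxBl mul1mx mulmxBr mulmx1 -scalemxAl -scalemxAr PP !scalerA.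
rewrite -[LHS]addrA -[RHS]addr0; congr (_ + _).
rewrite opprB addrCA addrA -scaleNr -!scaleNr -!scalerDl.
have a0' : a^* != 0 by rewrite conjC_eq0.
rewrite (_ : _ + _ = 0) ?scale0r //; field; exact/andP.
Qed.

(** Given [U] for the tail, reflect [U *m v] onto [w]. Equal Gram entries make every target of the
    tail orthogonal to [U *m v - w], so the reflection fixes it. *)
Lemma gram_unitary (s : seq ('cV[algC]_d * 'cV[algC]_d)) :
  {in s &, forall p q, dotc p.1 q.1 = dotc p.2 q.2} ->
  exists2 U : 'M[algC]_d, unitary U & {in s, forall p, U *m p.1 = p.2}.
Proof.
elim: s => [|[v w] s IHs] gram.
  by exists 1%:M => //; rewrite /unitary map_mx1 trmx1 mulmx1.
have [|U uU Us] := IHs.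
  by move=> p q ps qs; apply: gram; rewrite inE ?ps ?qs orbT.
have [|H uH [Hv Hfix]] := @reflection (U *m v) w.
  by rewrite dotc_unitary //; apply: (gram (v, w) (v, w)); rewrite inE eqxx.
exists (H *m U); first exact: unitaryM.
move=> p; rewrite inE => /predU1P[-> | ps] /=; first by rewrite -mulmxA.
rewrite -mulmxA (Us p ps) Hfix // dotcBl -{1}(Us p ps) dotc_unitary //.
by rewrite (gram (v, w) p) ?subrr ?inE ?eqxx ?ps ?orbT.
Qed.
End Gram.

(** * Query terms and chains of Gram matrices *)

(* One basis vector |z; qpos> of a family of states, with amplitude
   sqrt qwt * qamp f on the input with first_one = f. *)
Record qterm := QTerm { qpos : nat; qwt : rat; qamp : nat -> rat }.

(** [x <= qpos w] says that the queried bit is 1 when the first one is at [x]. *)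
Definition query (w : qterm) : qterm :=
  QTerm (qpos w) (qwt w) (fun x => (-1) ^+ (x <= qpos w)%N * qamp w x).

Definition gram (s : seq qterm) (x y : nat) : rat :=
  \sum_(w <- s) qwt w * (qamp w x * qamp w y).

Definition eqker (n : nat) (G H : nat -> nat -> rat) : Prop :=
  forall x y, (x < n)%N -> (y < n)%N -> G x y = H x y.

Fixpoint runs n G (L : seq (seq qterm)) H : Prop :=
  if L is s :: L' then
    eqker n G (gram s) /\ runs n (gram (map query s)) L' H
  else eqker n G H.

Definition validq n (s : seq qterm) := all (fun w => (qpos w < n)%N && (0 <= qwt w)) s.

Definition solves n (L : seq (seq qterm)) : Prop :=
  all (validq n) L /\ runs n (fun _ _ => 1) L (fun x y => (x == y)%:R).

Definition runker (L : seq (seq qterm)) t x y : rat :=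
  if (t < size L)%N then gram (nth [::] L t) x y else (x == y)%:R.

Lemma runs_start n L G : runs n G L (fun x y => (x == y)%:R) ->
  eqker n G (runker L 0).
Proof. by case: L => [|s L] //= []. Qed.

Lemma runs_step n L G t : runs n G L (fun x y => (x == y)%:R) ->
  (t < size L)%N ->
  eqker n (gram (map query (nth [::] L t))) (runker L t.+1).
Proof.
elim: L G t => [|s L IHL] G t //= [_ rL]; case: t => [_|t].
  by move: rL => /runs_start.
by rewrite ltnS => tL x y xn yn; rewrite (IHL _ _ rL tL).
Qed.

(** * From families of query terms to state vectors and an algorithm *)

Section Embedding.
Variables (N n Z : nat).
Local Notation d := (Z * n)%N.

Definition bvec (j : nat) : 'cV[algC]_d := \col_k ((k : nat) == j)%:R.

Lemma dotc_bvec i j : dotc (bvec i) (bvec j) = ((i == j) && (i < d)%N)%:R.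
Proof.
rewrite dotcE; case: ltnP => [id|di]; last first.
  rewrite andbF big1 // => k _; rewrite !mxE (ltn_eqF (leq_trans _ di)) //.
  by rewrite conjC0 mul0r.
rewrite (bigD1 (Ordinal id)) //= big1 ?addr0 => [|k kid]; last first.
  rewrite !mxE; have /negbTE-> : (k : nat) != i.
    by apply: contraNneq kid => ki; apply/eqP/val_inj.
  by rewrite conjC0 mul0r.
by rewrite !mxE eqxx conjC1 mul1r andbT.
Qed.

Definition wamp w x : algC := sqrtC (ratr (qwt w)) * ratr (qamp w x).

(** Successive terms get successive values of the [z] register, so they stay orthogonal even when
    they query the same position. *)
Fixpoint qvec z (s : seq qterm) (x : nat) : 'cV[algC]_d :=
  if s is w :: s' then wamp w x *: bvec (z * n + qpos w) + qvec z.+1 s' x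
  else 0.

Lemma dotc_bvec_qvec j z s x : (j < z * n)%N -> dotc (bvec j) (qvec z s x) = 0.
Proof.
elim: s z => [|w s IHs] z jz /=; first by rewrite dotcC dotc0l conjC0.
rewrite dotcDr dotcZr dotc_bvec IHs ?addr0; last by rewrite mulSn; lia.
by rewrite (_ : j == _ = false) ?mulr0 //; lia.
Qed.

Lemma dotc_qvec_disjoint z z' s s' x y :
  validq n s -> (z + size s <= z')%N -> dotc (qvec z s x) (qvec z' s' y) = 0.
Proof.
elim: s z => [|w s IHs] z /=; first by rewrite dotc0l.
case/andP=> /andP[wn _] vs zz; rewrite dotcDl dotcZl IHs //; last by lia.
rewrite dotc_bvec_qvec ?mulr0 ?addr0 //.
apply: (@leq_trans (z.+1 * n)); first by rewrite mulSn; lia.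
by rewrite leq_mul2r; lia.
Qed.

Lemma dotc_qvec z s x y :
  validq n s -> (z + size s <= Z)%N ->
  dotc (qvec z s x) (qvec z s y) = ratr (gram s x y).
Proof.
rewrite /gram; elim: s z => [|w s IHs] z /=; first by rewrite dotc0l big_nil rmorph0.
case/andP=> /andP[wn w0] vs zZ; rewrite big_cons rmorphD /= -(IHs z.+1) //; last by lia.
have zd : (z * n + qpos w < z.+1 * n)%N by rewrite mulSn; lia.
rewrite dotcDl !dotcDr !dotcZl dotcZr dotc_bvec_qvec // !mulr0 addr0.
rewrite dotcZr [dotc (qvec _ _ _) (bvec _)]dotcC dotc_bvec_qvec // conjC0 mulr0.
rewrite add0r; congr (_ + _).
rewrite dotc_bvec eqxx (leq_trans zd) ?leq_mul2r ?mulr1; last by lia.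
have -> : (wamp w x)^* = wamp w x.
  have sw : sqrtC (ratr (qwt w)) \is @Num.real algC.
    by rewrite ger0_real ?sqrtC_ge0 ?ler0q.
  by rewrite /wamp [LHS]rmorphM /= (conj_Creal sw) fmorph_rat.
rewrite /wamp mulrACA [X in X * _ = _](sqrtCK (ratr (qwt w))).
by rewrite -[X in _ * X]rmorphM -[LHS]rmorphM.
Qed.

Definition querytr (w : qterm) : qterm :=
  QTerm (qpos w) (qwt w)
    (fun x => (-1) ^+ ((qpos w < N) && (x <= qpos w))%N * qamp w x).

(* Positions [i >= N] carry no oracle phase, whereas [query] gives them the
   phase -1 for every [x < N]: a global phase. *)
Lemma gram_querytr s :
  eqker N (gram (map querytr s)) (gram (map query s)).
Proof.
move=> x y xN yN; rewrite /gram !big_map; apply: eq_bigr => w _ /=.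
case: ltnP => //= Nw; rewrite !(leq_trans (ltnW _) Nw) //.
by rewrite !expr0 !expr1 !mul1r !mulN1r mulrNN.
Qed.

Lemma validq_querytr s : validq n (map querytr s) = validq n s.
Proof. by rewrite /validq all_map. Qed.

Lemma oracle_bvec (x : N.-tuple bool) j :
  oracle Z n x *m bvec j
  = (-1) ^+ ((j %% n < N)%N && xbit x (j %% n)%N) *: bvec j.
Proof.
apply/matrixP => k l; rewrite !mxE (bigD1 k) //= !mxE eqxx big1 => [|i ik].
  rewrite addr0; case: eqP => [->|_]; last by rewrite !mulr0.
  by rewrite !mulr1; case: ifP.
by rewrite !mxE eq_sym (negbTE ik) mul0r.
Qed.

Lemma xbit_first_one (x : N.-tuple bool) i : admissible x -> (i < N)%N ->
  xbit x i = (first_one x <= i)%N.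
Proof.
move=> [mono last1] iN; rewrite /first_one; apply/idP/idP => [xi|].
  by rewrite leqNgt; apply/negP => /(before_find false) /=; rewrite -/(xbit _ _) xi.
move=> fi; apply: (mono _ _ fi iN); apply: (@nth_find _ false id).
by rewrite has_find size_tuple (leq_ltn_trans fi).
Qed.

Lemma first_one_lt (x : N.-tuple bool) : (0 < N)%N -> admissible x -> (first_one x < N)%N.
Proof.
by move=> N0 ax; have := ax.2; rewrite xbit_first_one ?prednK //; lia.
Qed.

Lemma oracle_qvec (x : N.-tuple bool) z s : admissible x -> validq n s ->
  oracle Z n x *m qvec z s (first_one x) = qvec z (map querytr s) (first_one x).
Proof.
move=> ax; elim: s z => [|w s IHs] z /=; first by rewrite mulmx0.
case/andP=> /andP[wn _] vs; rewrite mulmxDr IHs // -scalemxAr oracle_bvec.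
congr (_ + _); rewrite scalerA /wamp /= mulrC modnMDl modn_small //.
rewrite rmorphM rmorph_sign mulrCA; congr ((_ * (_ ^+ _ * _)) *: _); congr nat_of_bool.
by apply: andb_id2l => wN; rewrite xbit_first_one.
Qed.
End Embedding.

(* The register z < N holds the answer; during the run it holds the step
   number together with the index of the query term, starting from N, so that
   states of different steps are orthogonal and a single U serves all steps. *)
Lemma solves_algorithm N n L : solves n L -> (0 < N <= n)%N ->
  exists (Z : nat) (U : 'M[algC]_(Z * n)),
    (0 < Z)%N /\ unitary U /\ exact_for N (size L) U.
Proof.
move=> [vL rL] /andP[N0 Nn].
pose B := \max_(t < size L) size (nth [::] L t); pose Z := (N + size L * B)%N.
(* [st t x] is the state after [t] queries and the [U] that follows, [pr t x] the one just before
   that [U]. The last [st] is the basis vector |x;0>, of index [x * n]. *)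
pose st t x : 'cV[algC]_(Z * n) :=
  if (t < size L)%N then qvec n Z (N + t * B) (nth [::] L t) x
  else bvec n Z (x * n).
pose pr t x : 'cV[algC]_(Z * n) :=
  if t is t'.+1 then qvec n Z (N + t' * B) (map (querytr N) (nth [::] L t')) x
  else bvec n Z 0.
have d0 : (0 < Z * n)%N by rewrite muln_gt0 addn_gt0 N0; exact: leq_trans Nn.
have vt t : validq n (nth [::] L t).
  have [tL|Lt] := ltnP t (size L); last by rewrite nth_default.
  exact: (all_nthP [::] vL).
have szB t : (t < size L)%N -> (size (nth [::] L t) <= B)%N.
  by move=> tL; apply: (leq_bigmax (Ordinal tL)).
have endB t : (t < size L)%N -> (t.+1 * B <= size L * B)%N.
  by move=> tL; rewrite leq_mul2r tL orbT.
have st_lt t t' x y : (t < t')%N -> (t' <= size L)%N -> (x < N)%N -> (y < N)%N ->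
    dotc (st t x) (st t' y) = 0.
  move=> tt' t'L xN yN; have tL := leq_trans tt' t'L; rewrite /st tL.
  case: ltnP => t'L'.
    apply: dotc_qvec_disjoint => //; have := szB t tL.
    have : (t.+1 * B <= t' * B)%N by rewrite leq_mul2r tt' orbT.
    by rewrite mulSn; lia.
  rewrite dotcC dotc_bvec_qvec ?conjC0 // ltn_mul2r (leq_trans N0) //.
  by rewrite ltn_addr.
have pr_lt t t' x y : (t < t')%N -> (t' <= size L)%N ->
    dotc (pr t x) (pr t' y) = 0.
  case: t' => // t'; rewrite ltnS /pr => tt' t'L.
  case: t tt' => [_|t tt']; first by rewrite dotc_bvec_qvec // muln_gt0 addn_gt0 N0; lia.
  apply: dotc_qvec_disjoint; rewrite ?validq_querytr // size_map.
  have := szB t (ltn_trans tt' t'L).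
  have : (t.+1 * B <= t' * B)%N by rewrite leq_mul2r tt' orbT.
  by rewrite mulSn; lia.
have st_eq t x y : (t <= size L)%N -> (x < N)%N -> (y < N)%N ->
    dotc (st t x) (st t y) = ratr (runker L t x y).
  rewrite /st /runker => tL xN yN; case: ltnP => tL'.
    rewrite dotc_qvec //; have := szB t tL'; have := endB t tL'.
    by rewrite /Z mulSn; lia.
  rewrite dotc_bvec ratr_nat eqn_pmul2r ?(leq_trans N0) //.
  rewrite ltn_mul2r (leq_trans N0) // (leq_trans xN) ?andbT //.
  exact: leq_addr.
have pr_eq t x y : (t <= size L)%N -> (x < N)%N -> (y < N)%N ->
    dotc (pr t x) (pr t y) = ratr (runker L t x y).
  move=> tL xN yN; have [xn yn] := (leq_trans xN Nn, leq_trans yN Nn).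
  case: t tL => [_|t tL] /=.
    rewrite dotc_bvec eqxx -(runs_start rL) // rmorph1 /=.
    by rewrite d0.
  rewrite dotc_qvec ?validq_querytr //; last first.
    rewrite size_map; have := szB t tL; have := endB t tL.
    by rewrite /Z mulSn; lia.
  by rewrite gram_querytr // (runs_step rL).
(* All steps and inputs are handled at once: overlaps between different steps vanish on both sides,
   and those within a step agree by the chain. *)
have [|U uU Us] := @gram_unitary _
    [seq (pr t x, st t x) | t <- iota 0 (size L).+1, x <- iota 0 N].
  move=> _ _ /allpairsP[[t x] [tL xN ->]] /allpairsP[[t' y] [t'L yN ->]].
  move: tL xN t'L yN; rewrite !mem_iota !add0n /= !ltnS => tL xN t'L yN.
  case: (ltngtP t t') => [tt'|t't|<-].
  - by rewrite pr_lt // st_lt.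
  - by rewrite dotcC pr_lt // [RHS]dotcC st_lt.
  - by rewrite pr_eq // st_eq.
have Ust t x : (t <= size L)%N -> (x < N)%N -> U *m pr t x = st t x.
  move=> tL xN; apply: (Us (pr t x, st t x)); apply/allpairsP; exists (t, x).
  by rewrite !mem_iota !add0n ltnS.
exists Z, U; split; first by rewrite addn_gt0 N0.
split=> // x ax k; have fN := first_one_lt N0 ax.
have run t : (t <= size L)%N -> final_state t U x = st t (first_one x).
  elim: t => [|t IHt] tL; first by rewrite -Ust.
  rewrite /final_state iterS -/(final_state t U x) IHt 1?ltnW // -(Ust t.+1) //.
  by rewrite /st tL oracle_qvec.
rewrite run // /st ltnn mxE pnatr_eq0 eqb0 negbK => /eqP->.
by rewrite mulnK // (leq_trans N0).
Qed.

(** * Composition: search for the block, then inside it *)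

Lemma runs_eql n G G' L H : eqker n G' G -> runs n G L H -> runs n G' L H.
Proof.
case: L => [|s L] /= GG; first by move=> GH x y xn yn; rewrite GG ?GH.
by case=> Gs rL; split=> // x y xn yn; rewrite GG ?Gs.
Qed.

Lemma runs_eqr n G L H H' : eqker n H H' -> runs n G L H -> runs n G L H'.
Proof.
move=> HH; elim: L G => [|s L IHL] G /=; last by case=> Gs /IHL.
by move=> GH x y xn yn; rewrite GH ?HH.
Qed.

Lemma runs_cat n G L1 H L2 K :
  runs n G L1 H -> runs n H L2 K -> runs n G (L1 ++ L2) K.
Proof.
elim: L1 G => [|s L1 IHL] G /=; first exact: runs_eql.
by move=> [Gs r1] r2; split=> //; apply: IHL.
Qed.

Section Compose.
Variables n m : nat.
Hypothesis m_gt0 : (0 < m)%N.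

(** The last position of block [q] holds 1 exactly when the first one lies in a block of index at
    most [q]. *)
Definition coarse (w : qterm) : qterm :=
  QTerm (qpos w * m + m.-1) (qwt w) (fun x => qamp w (x %/ m)%N).

(** Every block has its own copy of the family, with amplitude zero on inputs whose first one lies
    in another block. *)
Definition refine (s : seq qterm) : seq qterm :=
  [seq QTerm (q * m + qpos w) (qwt w)
             (fun x => (x %/ m == q)%N%:R * qamp w (x %% m)%N) | q <- iota 0 n, w <- s].

Lemma leq_coarse x i : (x <= i * m + m.-1)%N = (x %/ m <= i)%N.
Proof.
by rewrite -ltnS -addnS prednK // -mulSnr -ltn_divLR // ltnS.
Qed.

Lemma gram_coarse s x y : gram (map coarse s) x y = gram s (x %/ m)%N (y %/ m)%N.
Proof. by rewrite /gram big_map. Qed.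

Lemma gram_query_coarse s x y :
  gram (map query (map coarse s)) x y = gram (map query s) (x %/ m)%N (y %/ m)%N.
Proof.
rewrite /gram !big_map; apply: eq_bigr => w _ /=.
by rewrite !leq_coarse.
Qed.

Lemma runs_coarse G L H : runs n G L H ->
  runs (n * m) (fun x y => G (x %/ m)%N (y %/ m)%N) (map (map coarse) L)
    (fun x y => H (x %/ m)%N (y %/ m)%N).
Proof.
have lt_div x : (x < n * m)%N -> (x %/ m < n)%N by rewrite ltn_divLR.
elim: L G => [|s L IHL] G /=.
  by move=> GH x y xn yn; rewrite GH ?lt_div.
case=> Gs rL; split=> [x y xn yn|]; first by rewrite gram_coarse Gs ?lt_div.
by apply: runs_eql (IHL _ rL) => x y _ _; rewrite gram_query_coarse.
Qed.

(** Only the copy for block [x %/ m] survives. The amplitude [f] is abstract so as to cover the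
    families both before and after a query. *)
Lemma gram_block s (f : nat -> qterm -> nat -> rat) x y :
  (x < n * m)%N ->
  \sum_(q <- iota 0 n) \sum_(w <- s)
     qwt w * ((x %/ m == q)%N%:R * f q w x * ((y %/ m == q)%N%:R * f q w y))
  = (x %/ m == y %/ m)%N%:R *
    \sum_(w <- s) qwt w * (f (x %/ m)%N w x * f (x %/ m)%N w y).
Proof.
rewrite -ltn_divLR // => xn.
rewrite (bigD1_seq (x %/ m)%N) ?iota_uniq ?mem_iota ?add0n //=.
rewrite [X in _ + X]big1 ?addr0 => [|q /negbTE xq]; last first.
  by rewrite big1 // => w _; rewrite eq_sym xq !mul0r mulr0.
rewrite eqxx mulr_sumr; apply: eq_bigr => w _.
by rewrite [in RHS]eq_sym mul1r; ring.
Qed.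

Lemma gram_refine s x y : (x < n * m)%N ->
  gram (refine s) x y = (x %/ m == y %/ m)%N%:R * gram s (x %% m)%N (y %% m)%N.
Proof.
move=> xn; rewrite /gram big_allpairs_dep /=.
exact: (gram_block _ (fun _ w x => qamp w (x %% m)%N)).
Qed.

Lemma gram_query_refine s x y : (x < n * m)%N ->
  gram (map query (refine s)) x y
  = (x %/ m == y %/ m)%N%:R * gram (map query s) (x %% m)%N (y %% m)%N.
Proof.
move=> xn; rewrite /gram !big_map big_allpairs_dep /=.
pose f q w x := (-1) ^+ (x <= q * m + qpos w)%N * qamp w (x %% m)%N.
transitivity (\sum_(q <- iota 0 n) \sum_(w <- s)
     qwt w * ((x %/ m == q)%N%:R * f q w x * ((y %/ m == q)%N%:R * f q w y))).
  by apply: eq_bigr => q _; apply: eq_bigr => w _; rewrite /f; ring.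
rewrite gram_block //; case: eqP => [xy|_]; last by rewrite !mul0r.
have leq_refine z i : (z <= z %/ m * m + i)%N = (z %% m <= i)%N.
  by rewrite {1}(divn_eq z m) leq_add2l.
rewrite !mul1r; apply: eq_bigr => w _ /=; rewrite /f leq_refine.
by rewrite xy leq_refine.
Qed.

Lemma runs_refine G L H : runs m G L H ->
  runs (n * m) (fun x y => (x %/ m == y %/ m)%N%:R * G (x %% m)%N (y %% m)%N)
    (map refine L)
    (fun x y => (x %/ m == y %/ m)%N%:R * H (x %% m)%N (y %% m)%N).
Proof.
elim: L G => [|s L IHL] G /=.
  by move=> GH x y xn yn; rewrite GH ?ltn_pmod.
case=> Gs rL; split=> [x y xn yn|]; first by rewrite gram_refine ?Gs ?ltn_pmod.
by apply: runs_eql (IHL _ rL) => x y xn _; rewrite gram_query_refine.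
Qed.

(** The coarse chain ends at the matrix of equality of blocks, where the refined chain starts; equal
    quotients and remainders then force equal positions. *)
Lemma solves_mul L1 L2 : solves n L1 -> solves m L2 ->
  solves (n * m) (map (map coarse) L1 ++ map refine L2).
Proof.
move=> [v1 r1] [v2 r2]; split.
  rewrite all_cat !all_map; apply/andP; split.
    apply: sub_all v1 => s; rewrite /validq /= all_map; apply: sub_all => w /=.
    case/andP=> wn ->; rewrite andbT -addnS prednK // -mulSnr.
    by rewrite leq_mul2r wn orbT.
  apply: sub_all v2 => s vs /=; rewrite /validq.
  have -> ss : all (fun w => (qpos w < n * m)%N && (0 <= qwt w)) (flatten ss)
      = all (validq (n * m)) ss by elim: ss => //= t ss IHss; rewrite all_cat IHss.
  rewrite all_map.
  apply/allP => q; rewrite mem_iota add0n /= /validq all_map => qn.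
  apply: sub_all vs => w /= /andP[wm ->]; rewrite andbT.
  by rewrite (@leq_trans (q.+1 * m)) ?leq_mul2r ?qn ?orbT // mulSn; lia.
apply: runs_cat (runs_coarse r1) _.
apply: runs_eqr (_ : runs _ _ (map refine L2) _); last first.
  by apply: runs_eql (runs_refine r2) => x y _ _; rewrite mulr1.
move=> x y _ _; rewrite -natrM mulnb; congr (nat_of_bool _)%:R.
apply/andP/eqP => [[/eqP xy /eqP xy']|-> //].
by rewrite (divn_eq x m) xy xy' -divn_eq.
Qed.
End Compose.

(** * Cyclic shifts and autocorrelations *)

Section Cyclic.
Variable n : nat.
Implicit Types (p : nat -> rat) (l : seq (rat * (nat -> rat))).

(** Coefficient at lag [e] of the squared modulus, on the unit circle, of the polynomial with
    coefficients [p 0], ..., [p (n - 1)]. *)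
Definition acorr p e : rat := \sum_(0 <= a < n - e) p (a + e)%N * p a.
Definition wcorr l e : rat := \sum_(q <- l) q.1 * acorr q.2 e.

(** The entries that wrap around are those with [j < x]; [b] makes the shift antiperiodic. *)
Definition cshift (b : bool) p j x : rat :=
  (-1) ^+ (b && (j < x))%N * p ((j + n - x) %% n)%N.

(** Cut the sum at [x] and [y]. On the outer pieces both shifts have wrapped or neither has, and
    together they form lag [y - x]; in the middle only the shift by [y] has wrapped, which gives the
    complementary lag and the sign. *)
Lemma cshift_corr b p x y : (x <= y < n)%N ->
  \sum_(0 <= j < n) cshift b p j x * cshift b p j y
  = acorr p (y - x) + (-1) ^+ b * acorr p (n - (y - x)).
Proof.
move=> /andP[xy yn]; have xn := leq_ltn_trans xy yn.
have low : \sum_(0 <= j < x) cshift b p j x * cshift b p j y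
         = \sum_(n - y <= a < n - (y - x)) p (a + (y - x))%N * p a.
  rewrite [RHS](big_addn 0) (_ : n - _ - _ = x)%N; last by lia.
  apply: eq_big_nat => j jx.
  have [jy jx' jn jn'] : [/\ (j < y)%N, (j < x)%N, (j + n - x < n)%N & (j + n - y < n)%N].
    by split; lia.
  rewrite /cshift jx' jy mulrACA -signr_addb addbb mul1r !modn_small //.
  by congr (p _ * p _); lia.
have mid : \sum_(x <= j < y) cshift b p j x * cshift b p j y
         = (-1) ^+ b * acorr p (n - (y - x)).
  rewrite /acorr [LHS](big_addn 0) (_ : n - (n - _) = y - x)%N; last by lia.
  rewrite mulr_sumr; apply: eq_big_nat => j jx.
  have [jx' jy jn jn'] : [/\ (j + x < x)%N = false, (j + x < y)%N, (j < n)%N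
      & (j + x + n - y < n)%N] by split; lia.
  rewrite /cshift jx' jy andbF andbT mul1r [in LHS]mulrCA; congr (_ * _).
  rewrite mulrC (_ : j + x + n - x = j + n)%N; last by lia.
  by rewrite modnDr !modn_small //; congr (p _ * p _); lia.
have high : \sum_(y <= j < n) cshift b p j x * cshift b p j y
         = \sum_(0 <= a < n - y) p (a + (y - x))%N * p a.
  rewrite [LHS](big_addn 0); apply: eq_big_nat => j jx.
  have [jx' jy jn jn'] : [/\ (j + y < x)%N = false, (j + y < y)%N = false, (j < n)%N
      & (j + (y - x) < n)%N] by split; lia.
  rewrite /cshift jx' jy andbF !mul1r.
  rewrite (_ : j + y + n - x = j + (y - x) + n)%N; last by lia.
  rewrite (_ : j + y + n - y = j + n)%N; last by lia.
  by rewrite !modnDr !modn_small.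
rewrite (big_cat_nat (n := x)) ?(ltnW xn) //= low.
rewrite [X in _ + X = _](big_cat_nat (n := y)) ?(ltnW yn) //= mid high.
rewrite [acorr p (y - x)](big_cat_nat (n := (n - y)%N)) //=; last by lia.
ring.
Qed.

Definition cyclic_terms b l : seq qterm :=
  [seq QTerm j q.1 (cshift b q.2 j) | q <- l, j <- iota 0 n].

Lemma gram_cyclic b l x y : (x <= y < n)%N ->
  gram (cyclic_terms b l) x y
  = wcorr l (y - x) + (-1) ^+ b * wcorr l (n - (y - x)).
Proof.
move=> xyn; rewrite /gram big_allpairs_dep /= mulr_sumr -big_split /=.
apply: eq_bigr => q _; rewrite mulrCA -mulrDr -cshift_corr //.
by rewrite mulr_sumr /index_iota subn0.
Qed.

(** The query sign for [x <= j] is minus the wrap sign for [j < x], and this minus cancels in a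
    product of two amplitudes. *)
Lemma gram_query_cyclic b l x y : 
  gram (map query (cyclic_terms b l)) x y = gram (cyclic_terms (~~ b) l) x y.
Proof.
rewrite /gram big_map !big_allpairs_dep /=.
apply: eq_bigr => q _; apply: eq_bigr => j _ /=; congr (_ * _).
by rewrite /cshift !(leqNgt _ j); case: b; case: (j < x)%N; case: (j < y)%N => /=; ring.
Qed.

Lemma gramC s x y : gram s x y = gram s y x.
Proof. by apply: eq_bigr => w _; rewrite [qamp w x * _]mulrC. Qed.

Lemma validq_cyclic b l : all (fun q => 0 <= q.1) l ->
  validq n (cyclic_terms b l).
Proof.
elim: l => //= q l IHl /andP[q0 /IHl vl].
rewrite /validq all_cat [X in _ && X]vl andbT all_map.
by apply/allP => j; rewrite mem_iota /= q0 add0n andbT.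
Qed.

(* One query negates the part of a cyclic shift that does not wrap around, i.e.
   exchanges periodic and antiperiodic boundary conditions. *)
Lemma three_queries l1 l2 l3 :
  all (fun q => 0 <= q.1) l1 -> all (fun q => 0 <= q.1) l2 ->
  all (fun q => 0 <= q.1) l3 ->
  (forall e, (e < n)%N ->
    [/\ wcorr l1 e + wcorr l1 (n - e) = 1,
        wcorr l1 e - wcorr l1 (n - e) = wcorr l2 e - wcorr l2 (n - e),
        wcorr l2 e + wcorr l2 (n - e) = wcorr l3 e + wcorr l3 (n - e) &
        wcorr l3 e - wcorr l3 (n - e) = (e == 0%N)%:R]) ->
  solves n [:: cyclic_terms false l1; cyclic_terms true l2; cyclic_terms false l3].
Proof.
move=> p1 p2 p3 eqs; split; first by rewrite /= !validq_cyclic.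
have sym G H : (forall x y, G x y = G y x) -> (forall x y, H x y = H y x) ->
    (forall x y, (x <= y < n)%N -> G x y = H x y) -> eqker n G H.
  move=> GC HC GH x y xn yn; case/orP: (leq_total x y) => xy.
    by apply: GH; rewrite xy.
  by rewrite GC HC; apply: GH; rewrite xy.
have dlt x y : (x <= y < n)%N -> (y - x < n)%N by lia.
split; [|split; [|split]]; apply: sym; try exact: gramC; try by [];
  try (by move=> x y; rewrite eq_sym); move=> x y xyn;
  have [e1 e2 e3 e4] := eqs _ (dlt _ _ xyn);
  rewrite ?gram_query_cyclic !gram_cyclic //= ?expr0 ?expr1 ?mul1r ?mulN1r.
- by rewrite e1.
- by rewrite e2.
- by rewrite e3.
- by rewrite e4; congr (nat_of_bool _)%:R; lia.
Qed.
End Cyclic.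

(** * Certificates for nonnegative trigonometric polynomials *)

Section PositiveCorrelation.
Variable n : nat.

(** Nonnegativity is witnessed by a rational weighted sum of squared moduli, since an exact
    Fejer-Riesz factor may be irrational. *)
Definition poscorr (s : nat -> rat) : Prop :=
  exists2 l, all (fun q => 0 <= q.1) l & forall e, (e < n)%N -> wcorr n l e = s e.

Lemma poscorrD s t : poscorr s -> poscorr t -> poscorr (fun e => s e + t e).
Proof.
move=> [l l0 ls] [k k0 kt]; exists (l ++ k); first by rewrite all_cat l0.
by move=> e en; rewrite /wcorr big_cat /= -ls // -kt.
Qed.

Lemma poscorr_acorr c p : 0 <= c -> poscorr (fun e => c * acorr n p e).
Proof.
move=> c0; exists [:: (c, p)]; first by rewrite /= c0.
by move=> e _; rewrite /wcorr big_seq1.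
Qed.

Lemma sum_nat_delta (F : nat -> rat) m c :
  \sum_(0 <= a < m) F a * (a == c)%:R = (c < m)%N%:R * F c.
Proof.
case: ltnP => cm; last first.
  rewrite mul0r big_nat big1 // => a /andP[_ am].
  by rewrite (ltn_eqF (leq_trans am cm)) mulr0.
rewrite (bigD1_seq c) ?mem_index_iota ?iota_uniq //= eqxx mulrC.
by rewrite big1 ?addr0 // => a /negbTE->; rewrite mulr0.
Qed.

(* As a trigonometric polynomial, r = sum_d |r_d| |1 +- z^d|^2 + const. *)
Lemma poscorr_dominant r :
  2 * (\sum_(1 <= e < n) `|r e|) <= r 0%N -> poscorr r.
Proof.
move=> r0.
pose p d a : rat := (a == 0)%N%:R + (-1) ^+ (r d < 0)%R * (a == d)%:R.
pose l := [seq (`|r d|, p d) | d <- index_iota 1 n].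
exists ((r 0%N - 2 * \sum_(1 <= e < n) `|r e|, fun a => (a == 0)%N%:R) :: l).
  rewrite /= subr_ge0 r0 /= all_map; apply/allP => d _ /=; exact: normr_ge0.
move=> e en; rewrite /wcorr big_cons big_map /= [acorr _ _ e]sum_nat_delta.
rewrite add0n subn_gt0 en mul1r.
have pE d : (0 < d < n)%N ->
    `|r d| * acorr n (p d) e = 2 * `|r d| * (e == 0)%N%:R + r d * (d == e)%:R.
  move=> /andP[d0 dn]; rewrite [in X in _ = _ + X](numEsign (r d)).
  rewrite /acorr; set sg := (-1) ^+ _.
  have sg2 : sg * sg = 1 by rewrite /sg -signr_addb addbb.
  under eq_bigr => a _ do rewrite [p d a]/p -/sg mulrDr mulrCA.
  rewrite big_split /= -mulr_sumr !sum_nat_delta add0n subn_gt0 en /p -/sg.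
  have [-> ->] : (d + e == 0)%N = false /\ (d + e == d)%N = (e == 0)%N by split; lia.
  rewrite [e == d]eq_sym; have [e0|_] := eqVneq e 0%N.
    rewrite e0 subn0 dn (gtn_eqF d0) /= !(mulr0, mulr1, mul1r, add0r, addr0).
    by rewrite sg2; ring.
  by rewrite /=; ring.
rewrite [X in _ + X](eq_big_nat _ _ pE) big_split /= -mulr_suml -mulr_sumr.
have [->|e0] := eqVneq e 0%N.
  rewrite [X in _ + (_ + X)]big_nat [X in _ + (_ + X)]big1 => [|d /andP[d0 _]].
    by rewrite addr0 !mulr1 subrK.
  by rewrite (gtn_eqF d0) mulr0.
rewrite !mulr0 !add0r (bigD1_seq e) ?mem_index_iota ?iota_uniq ?lt0n ?e0 //=.
by rewrite eqxx mulr1 big1 ?addr0 // => d /negbTE->; rewrite mulr0.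
Qed.

Lemma poscorr_approx c p s : 0 <= c ->
  2 * (\sum_(1 <= e < n) `|s e - c * acorr n p e|) <= s 0%N - c * acorr n p 0 ->
  poscorr s.
Proof.
move=> c0 /poscorr_dominant ps.
have [l l0 ls] := poscorrD ps (poscorr_acorr p c0).
by exists l => // e en; rewrite ls // subrK.
Qed.

(** The hypothesis of [poscorr_approx] with denominators cleared, over binary integers so that
    evaluation can decide it. *)
Definition Zresidual (P t : seq Z) (e : nat) : Z :=
  t`_e - foldr (fun a z => P`_(a + e)%N * P`_a + z) 0 (iota 0 (n - e)).

Definition Zdominant (P t : seq Z) : bool :=
  Zresidual P t 0 - foldr (fun e z => `|Zresidual P t e| *+ 2 + z) 0 (iota 1 n.-1)
    >= 0.

Variable f : {rmorphism Z -> rat}.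
Hypothesis f_ge0 : forall z, (0 <= f z) = (0 <= z).

Lemma poscorr_Z (D : Z) (P t : seq Z) : 0 <= D -> Zdominant P t ->
  poscorr (fun e => f t`_e / f D).
Proof.
move=> D0 dom; apply: (@poscorr_approx (f D)^-1 (fun a => f P`_a)).
  by rewrite invr_ge0 f_ge0.
have sumE (R : nmodType) (F : nat -> R) i j :
    foldr (fun e z => F e + z) 0 (iota i j) = \sum_(e <- iota i j) F e.
  by elim: j i => [|j IHj] i /=; rewrite ?big_nil ?big_cons ?IHj.
have resE e : f t`_e / f D - (f D)^-1 * acorr n (fun a => f P`_a) e
            = f (Zresidual P t e) / f D.
  rewrite mulrC -mulrBr mulrC; congr (_ / _).
  rewrite /Zresidual sumE rmorphB; congr (_ - _); rewrite rmorph_sum /=.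
  by rewrite /acorr /index_iota subn0; apply: eq_bigr => a _; rewrite rmorphM.
have f_norm z : `|f z| = f `|z|.
  case/orP: (le_total 0 z) => z0; first by rewrite !ger0_norm ?f_ge0.
  by rewrite !ler0_norm ?rmorphN // -oppr_ge0 -rmorphN f_ge0 oppr_ge0.
have normD : `|f D| = f D by rewrite ger0_norm ?f_ge0.
rewrite resE; under eq_bigr => e _ do rewrite resE normrM normfV normD f_norm.
rewrite -mulr_suml mulrA ler_wpM2r ?invr_ge0 ?f_ge0 // -subr_ge0.
rewrite -(rmorph_sum f) mulr_natl -rmorphMn -rmorphB f_ge0.
by move: dom; rewrite /Zdominant sumE sumrMnl /index_iota subn1.
Qed.
End PositiveCorrelation.

(* The certificate for 27 items and 3 queries *)
Delimit Scope Z_scope with coqZ.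

(* Diagonal sums s1, s2, s3 for [three_queries], scaled by 27000. The conditions
   force s1_d = 1 - d/27, s3_d = e_d and s2_d = e_d + 1/2 - d/27 for d > 0, with
   e_d = e_(27-d) free; the e_d were found numerically by maximising the minimum
   over theta of the two polynomials s_0 + 2 sum_d s_d cos(d theta), and factor2,
   factor3 are rounded Fejer-Riesz factors of these polynomials. *)
Definition target1 : seq Z := [seq (1000 * (27 - Z.of_nat e))%coqZ | e <- iota 0 27].
Definition target2 : seq Z := (
  [:: 27000; 19683; 15826; 12861; 10475; 8447; 6654; 5033; 3545; 2168;
    883; -320; -1452; -2516; -3516; -4452; -5320; -6117; -6832; -7455;
    -7967; -8346; -8553; -8525; -8139; -7174; -5317])%coqZ.
Definition target3 : seq Z := (
  [:: 27000; 7183; 4326; 2361; 975; -53; -846; -1467; -1955; -2332; -2617;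
    -2820; -2952; -3016; -3016; -2952; -2820; -2617; -2332; -1955; -1467;
    -846; -53; 975; 2361; 4326; 7183])%coqZ.
Definition factor2 : seq Z := (
  [:: 83; 60; 47; 36; 30; 26; 22; 18; 15; 12; 10; 7; 5; 3; 0; -2; -5; -7;
    -10; -13; -15; -19; -23; -29; -33; -40; -64])%coqZ.
Definition factor3 : seq Z := (
  [:: 107; 28; 20; 10; 2; -4; -7; -9; -12; -12; -13; -14; -14; -13; -11;
    -11; -11; -10; -8; -8; -7; -4; -4; -2; 4; 23; 67])%coqZ.

Lemma wcorr_ge n l e : (n <= e)%N -> wcorr n l e = 0.
Proof.
move=> ne; rewrite /wcorr big1 // => q _.
by rewrite /acorr (eqP ne) big_geq ?mulr0.
Qed.

Lemma search27 : exists2 L, solves 27 L & size L = 3.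
Proof.
(* The existential hides the body of the embedding, so that simplification cannot unfold it. *)
have [f f_ge0] : exists f : {rmorphism Z -> rat}, forall z, (0 <= f z) = (0 <= z).
  exists (intr \o int_of_Z : {rmorphism Z -> rat}) => z.
  by rewrite /= ler0z; lia.
pose D := 27000%coqZ.
(* The triangular sequence is, up to scaling, the autocorrelation of the constant 1. *)
have [l1 l10 l1E] : poscorr 27 (fun e => f target1`_e / f D).
  have [|l l0 lE] := @poscorr_acorr 27 (f 1000%coqZ / f D) (fun=> 1).
    by rewrite divr_ge0 ?f_ge0.
  exists l => // e en; rewrite lE // /acorr mulrAC; congr (_ / _).
  rewrite (nth_map 0%N) ?size_iota // nth_iota // add0n big_const_nat subn0.
  rewrite iter_addr addr0 mulr1 rmorphM; congr (_ * _).
  rewrite rmorphB /= (natrB _ (ltnW en)) -[27%:R](rmorph_nat f) -[e%:R](rmorph_nat f).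
  by congr (f _ - f _); lia.
have [l2 l20 l2E] : poscorr 27 (fun e => f target2`_e / f D).
  by apply: (@poscorr_Z 27 f f_ge0 D factor2 target2) => //; vm_compute.
have [l3 l30 l3E] : poscorr 27 (fun e => f target3`_e / f D).
  by apply: (@poscorr_Z 27 f f_ge0 D factor3 target3) => //; vm_compute.
exists [:: cyclic_terms 27 false l1; cyclic_terms 27 true l2;
           cyclic_terms 27 false l3] => //.
(* At [e = 0] the complementary lag is 27, past the end of the table: the correlation and the
   default of [nth] are both 0 there. *)
have ext l t : (forall e, (e < 27)%N -> wcorr 27 l e = f t`_e / f D) ->
    size t = 27%N -> forall e, wcorr 27 l e = f t`_e / f D.
  move=> lE st e; have [/lE//|e27] := ltnP e 27.
  by rewrite wcorr_ge // nth_default ?st // rmorph0 mul0r.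
(* The conditions of [three_queries] multiplied by [D] are integer identities. *)
have checks : all (fun e => [&& target1`_e + target1`_(27 - e) == D,
    target1`_e - target1`_(27 - e) == target2`_e - target2`_(27 - e),
    target2`_e + target2`_(27 - e) == target3`_e + target3`_(27 - e) &
    target3`_e - target3`_(27 - e) == if e is 0 then D else 0]) (iota 0 27).
  by vm_compute.
apply: three_queries => // e en.
rewrite !(ext _ _ l1E) // !(ext _ _ l2E) // !(ext _ _ l3E) //.
rewrite -!mulrBl -!mulrDl -!rmorphD -!rmorphB.
have e27 : e \in iota 0 27 by rewrite mem_iota.
have /and4P[/eqP-> /eqP-> /eqP-> /eqP->] := allP checks e e27.
have D0 : f D != 0.
  by apply/eqP => fD; have := f_ge0 (- D); rewrite rmorphN fD oppr0 lexx.
by rewrite divff //; split=> //; case: (e) => [|e']; rewrite ?divff // rmorph0 mul0r.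
Qed.

(** * Powers of 27 and the query count *)

Lemma search_pow27 m : exists2 L, solves (27 ^ m.+1) L & size L = (3 * m.+1)%N.
Proof.
have [L0 s0 z0] := search27.
elim: m => [|m [L sL zL]]; first by exists L0; rewrite ?expn1.
exists (map (map (coarse (27 ^ m.+1))) L0 ++ map (refine 27 (27 ^ m.+1)) L).
  by rewrite [(27 ^ m.+2)%N]expnS; apply: solves_mul; rewrite ?expn_gt0.
by rewrite size_cat !size_map z0 zL [RHS]mulnS.
Qed.

Lemma ln_INR_expn b k : (0 < b)%N ->
  ln (INR (b ^ k)) = Rmult (INR k) (ln (INR b)).
Proof.
move=> b0; have INR_gt0 j : (0 < j)%N -> Rlt 0 (INR j) by move=> /ssrnat.ltP/lt_0_INR.
elim: k => [|k IHk]; first by rewrite expn0 /= ln_1 Rmult_0_l.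
rewrite expnS -multE mult_INR ln_mult ?IHk ?S_INR;
  try by apply: INR_gt0; rewrite ?expn_gt0 ?b0.
by rewrite Rmult_plus_distr_r Rmult_1_l Rplus_comm.
Qed.

(** With [m = up_log 27 N], minimality gives [27 ^ (m - 1) < N], so [3 * (m - 1)] is below the base
    3 logarithm of [N]: rounding up to a power of 27 costs at most 3 queries. *)
Lemma up_log27_bound N : (2 <= N)%N ->
  Rle (INR (3 * up_log 27 N)) (Rplus (Rdiv (ln (INR N)) (ln (INR 3))) (INR 3)).
Proof.
move=> N2; have /andP[lo _] := up_log_bounds (isT : 1 < 27)%N N2.
have m0 : (0 < up_log 27 N)%N by rewrite up_log_gt0.
have ln3 : Rlt 0 (ln (INR 3)) by rewrite -ln_1; apply: ln_increasing; rewrite /=; lra.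
have : Rlt (ln (INR (27 ^ (up_log 27 N).-1))) (ln (INR N)).
  apply: ln_increasing; last exact/lt_INR/ssrnat.ltP.
  by apply/lt_0_INR/ssrnat.ltP; rewrite expn_gt0.
have -> k : (27 ^ k = 3 ^ (3 * k))%N by rewrite (expnM 3 3).
rewrite ln_INR_expn // => lnN.
have -> : (3 * up_log 27 N = 3 * (up_log 27 N).-1 + 3)%N by lia.
rewrite -plusE plus_INR; apply: Rplus_le_compat_r.
apply: (Rmult_le_reg_r (ln (INR 3))) => //.
rewrite /Rdiv Rmult_assoc Rinv_l ?Rmult_1_r; last by apply: Rgt_not_eq.
exact: Rlt_le.
Qed.

Theorem theorem4 :
  exists C : R,
  forall N : nat, (2 <= N)%N ->
  exists (Zd Md T : nat) (U : 'M[algC]_(Zd * Md)),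
    (N <= Md)%N /\ (0 < Zd)%N /\ unitary U /\
    Rle (INR T) (Rplus (Rdiv (ln (INR N)) (ln (INR 3))) C) /\
    exact_for N T U.
Proof.
exists (INR 3) => N N2; set m := up_log 27 N.
have /andP[_ Nm] := up_log_bounds (isT : 1 < 27)%N N2.
have m0 : (0 < m)%N by rewrite up_log_gt0.
have [L sL zL] := search_pow27 m.-1; rewrite prednK // in sL zL.
have [|Z [U [Z0 [uU eU]]]] := solves_algorithm sL (_ : 0 < N <= _)%N.
  by rewrite Nm (ltnW N2).
(* The positions from [N] up to [27 ^ m] are padding, on which the oracle acts trivially. *)
exists Z, (27 ^ m)%N, (size L), U; do 4 (split => //).
by rewrite zL; apply: up_log27_bound.
Qed.
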